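(* Let $H,A,Q$ be functions on $\mathbb{Z}^2$ satisfying the discrete Tzitz\'eica system $$H_{12}=-\frac{H(H-1)}{H[H(H_1-1)(H_2-1)-(H-1)]-AQH_1H_2},\qquad A_2=\frac{H_1}{H}A,\quad Q_1=\frac{H_2}{H}Q .$$ Then the linear frame equations $$\hat F_1=\begin{pmatrix}1&1&0&0\\ A&A+\frac{H_1-1}{H_1(H-1)}&\frac{AH}{H-1}&\frac{AH}{H-1}\\ H-1&H-1&H&H\\ 0&\frac{H_1-1}{H_1}&0&\frac{(H_1-1)H}{H_1(H-1)}\end{pmatrix}\hat F,\qquad \hat F_2=\begin{pmatrix}1&0&1&0\\ H-1&H&H-1&H\\ Q&\frac{QH}{H-1}&Q+\frac{H_2-1}{H_2(H-1)}&\frac{QH}{H-1}\\ 0&0&\frac{H_2-1}{H_2}&\frac{(H_2-1)H}{H_2(H-1)}\end{pmatrix}\hat F$$ for $\hat F=(\hat r,\hat r^1,\hat r^2,\hat r^{12})^T$ encode the class of projective transforms of discrete affine spheres. That is, a map $\hat r:\mathbb{Z}^2\to\mathbb{R}^4$ is the first row of a non-degenerate solution $\hat F$ if and only if, up to a constant invertible linear transformation of $\mathbb{R}^4$, $\hat r=(r^a,1)$, where $r^a:\mathbb{Z}^2\to\mathbb{R}^3$ is a discrete affine sphere with the same $H,A,Q$, i.e. (non-degenerately) satisfies $$\begin{aligned} r^a_{11}-r^a_1&=\frac{H_1-1}{H_1(H-1)}(r^a_1-r^a)+\frac{A}{H-1}(r^a_{12}-r^a_1),\\ r^a_{12}+r^a&=H(r^a_1+r^a_2),\\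 r^a_{22}-r^a_2&=\frac{H_2-1}{H_2(H-1)}(r^a_2-r^a)+\frac{Q}{H-1}(r^a_{12}-r^a_2). \end{aligned}$$
   Context: For a function $h$ on $\mathbb{Z}^2$, $h_1(n_1,n_2)=h(n_1+1,n_2)$, $h_2(n_1,n_2)=h(n_1,n_2+1)$, and multiple subscripts denote repeated shifts. The superscripts in $\hat r^1,\hat r^2,\hat r^{12}$ and in $r^a$ (''affine'') are labels. All denominators are assumed non-zero. $\hat F$ is a $4\times4$-matrix-valued function whose rows are $\hat r,\hat r^1,\hat r^2,\hat r^{12}\in\mathbb{R}^4$; it is non-degenerate if these rows are linearly independent at every point. Correspondingly, $r^a$ is called non-degenerate if $(r^a,1),(r^a_1,1),(r^a_2,1),(r^a_{12},1)$ are linearly independent at every point. Discrete affine spheres are the lattices $r^a$ in $\mathbb{R}^3$ governed by the last displayed system (their standard Gauss-Weingarten equations in centro-affine geometry). *)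

(* Defs.v *)
From mathcomp Require Import all_boot all_order all_algebra.
From mathcomp Require Import reals.

Set Implicit Arguments.
Unset Strict Implicit.
Unset Printing Implicit Defensive.

Import GRing.Theory Num.Theory.
Local Open Scope ring_scope.

(* A function h on Z^2 is curried: [h n1 n2]. *)
Definition shift1 (T : Type) (h : int -> int -> T) : int -> int -> T :=
  fun n1 n2 => h (n1 + 1) n2.

Definition shift2 (T : Type) (h : int -> int -> T) : int -> int -> T :=
  fun n1 n2 => h n1 (n2 + 1).

Definition tzitzeica_denom (R : realType) (H A Q : int -> int -> R)
    (n1 n2 : int) : R :=
  let h := H n1 n2 in
  let h1 := shift1 H n1 n2 in
  let h2 := shift2 H n1 n2 in
  h * (h * (h1 - 1) * (h2 - 1) - (h - 1)) - A n1 n2 * Q n1 n2 * h1 * h2.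

(* Non-vanishing, at every point, of each denominator occurring in the
   Tzitzeica system, in the frame equations and in the Gauss-Weingarten
   equations: H, H_1, H_2, H - 1 and [tzitzeica_denom]. *)
Definition denominators_neq0 (R : realType) (H A Q : int -> int -> R) : Prop :=
  forall n1 n2 : int,
    [/\ H n1 n2 != 0, H n1 n2 - 1 != 0 & tzitzeica_denom H A Q n1 n2 != 0].

Definition discrete_tzitzeica (R : realType) (H A Q : int -> int -> R) : Prop :=
  forall n1 n2 : int,
    [/\ shift2 (shift1 H) n1 n2 =
          - (H n1 n2 * (H n1 n2 - 1) / tzitzeica_denom H A Q n1 n2),
        shift2 A n1 n2 = shift1 H n1 n2 / H n1 n2 * A n1 n2
      & shift1 Q n1 n2 = shift2 H n1 n2 / H n1 n2 * Q n1 n2].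

Definition mx_rows4 (R : realType) (u v w x : 'rV[R]_4) : 'M[R]_4 :=
  \matrix_(i < 4) nth 0 [:: u; v; w; x] i.

Definition rv4 (R : realType) (a b c d : R) : 'rV[R]_4 :=
  \row_(j < 4) nth 0 [:: a; b; c; d] j.

Definition frame_mx1 (R : realType) (H A : int -> int -> R)
    (n1 n2 : int) : 'M[R]_4 :=
  let h := H n1 n2 in
  let h1 := shift1 H n1 n2 in
  let a := A n1 n2 in
  mx_rows4
    (rv4 1       1                                 0               0)
    (rv4 a       (a + (h1 - 1) / (h1 * (h - 1)))   (a * h / (h - 1)) (a * h / (h - 1)))
    (rv4 (h - 1) (h - 1)                           h               h)
    (rv4 0       ((h1 - 1) / h1)                   0  ((h1 - 1) * h / (h1 * (h - 1)))).

Definition frame_mx2 (R : realType) (H Q : int -> int -> R)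
    (n1 n2 : int) : 'M[R]_4 :=
  let h := H n1 n2 in
  let h2 := shift2 H n1 n2 in
  let q := Q n1 n2 in
  mx_rows4
    (rv4 1       0                 1                               0)
    (rv4 (h - 1) h                 (h - 1)                         h)
    (rv4 q       (q * h / (h - 1)) (q + (h2 - 1) / (h2 * (h - 1))) (q * h / (h - 1)))
    (rv4 0       0                 ((h2 - 1) / h2)  ((h2 - 1) * h / (h2 * (h - 1)))).

(* The rows of [F n1 n2] are rhat, rhat^1, rhat^2, rhat^12. *)
Definition frame_equations (R : realType) (H A Q : int -> int -> R)
    (F : int -> int -> 'M[R]_4) : Prop :=
  forall n1 n2 : int,
    shift1 F n1 n2 = frame_mx1 H A n1 n2 *m F n1 n2 /\
    shift2 F n1 n2 = frame_mx2 H Q n1 n2 *m F n1 n2.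

Definition frame_nondegenerate (R : realType)
    (F : int -> int -> 'M[R]_4) : Prop :=
  forall n1 n2 : int, row_free (F n1 n2).

Definition homogeneous (R : realType) (v : 'rV[R]_3) : 'rV[R]_4 :=
  row_mx v (const_mx 1 : 'rV[R]_1).

Definition discrete_affine_sphere (R : realType) (H A Q : int -> int -> R)
    (r : int -> int -> 'rV[R]_3) : Prop :=
  forall n1 n2 : int,
    let h := H n1 n2 in
    let h1 := shift1 H n1 n2 in
    let h2 := shift2 H n1 n2 in
    let r0 := r n1 n2 in
    let r1 := shift1 r n1 n2 in
    let r2 := shift2 r n1 n2 in
    let r11 := shift1 (shift1 r) n1 n2 in
    let r12 := shift2 (shift1 r) n1 n2 in
    let r22 := shift2 (shift2 r) n1 n2 in
    [/\ r11 - r1 = ((h1 - 1) / (h1 * (h - 1))) *: (r1 - r0)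
                   + (A n1 n2 / (h - 1)) *: (r12 - r1),
        r12 + r0 = h *: (r1 + r2)
      & r22 - r2 = ((h2 - 1) / (h2 * (h - 1))) *: (r2 - r0)
                   + (Q n1 n2 / (h - 1)) *: (r12 - r2)].

Definition affine_nondegenerate (R : realType)
    (r : int -> int -> 'rV[R]_3) : Prop :=
  forall n1 n2 : int,
    row_free (mx_rows4 (homogeneous (r n1 n2))
                       (homogeneous (shift1 r n1 n2))
                       (homogeneous (shift2 r n1 n2))
                       (homogeneous (shift2 (shift1 r) n1 n2))).

(* Main.v *)
Require Import Defs.
From mathcomp Require Import all_boot all_order all_algebra.
From mathcomp Require Import reals.
From mathcomp Require Import ring.

Set Implicit Arguments.
Unset Strict Implicit.
Unset Printing Implicit Defensive.

Import GRing.Theory Num.Theory.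
Local Open Scope ring_scope.

(** The first row of the frame equations gives [rhat^1 = rhat_1 - rhat] and
    [rhat^2 = rhat_2 - rhat], so only [rhat^12] needs an interpretation.  For
    [rho = (r, 1)] with [r] an affine sphere, the relation [r_12 + r = H (r_1 + r_2)]
    becomes [rho_12 + rho = H (rho_1 + rho_2) + 2 (1 - H) e] with [e = (0, 0, 0, 1)],
    and comparison with the third row of the first frame equation forces
    [rhat^12 = (H - 1) / H (rho - 2 e)].  With this choice ([affine_frame]) the
    frame equations are the Gauss-Weingarten equations in disguise
    ([affine_frame_equations], [affine_sphere_of_frame_equations]), and the frame is
    an invertible combination of [rho, rho_1, rho_2, rho_12]
    ([affine_frame_neighbours]).

    It remains to bring an arbitrary non-degenerate solution to this form by one
    constant linear map.  Every solution has two conserved quantities: the vector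
    [rhat - H / (H - 1) rhat^12] ([center_conserved]) and the linear functional with
    values [1, 0, 0, (1 - H) / H] on the four rows ([height_conserved]).  They are
    twice the center of the sphere in homogeneous coordinates and the equation of
    the affine chart.  If a linear map sends the center to [e] and the functional to
    the last coordinate, the solution becomes an affine frame
    ([affine_frame_of_normalized]).  Such a map is obtained by prescribing a
    suitable frame at the origin of the lattice ([origin_frame]); conservation then
    propagates the normalisation to all of it. *)

(** * Functions on the lattice *)

Lemma int_shift_const (T : Type) (f : int -> T) :
  (forall n, f (n + 1) = f n) -> forall n, f n = f 0.
Proof.
move=> fS; elim=> // n IHn; first by rewrite -addn1 PoszD fS.
by rewrite -IHn -[in LHS]fS -addn1 PoszD opprD subrK.
Qed.

Lemma lattice_shift_const (T : Type) (f : int -> int -> T) :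
  (forall n1 n2, shift1 f n1 n2 = f n1 n2) ->
  (forall n1 n2, shift2 f n1 n2 = f n1 n2) ->
  forall n1 n2, f n1 n2 = f 0 0.
Proof.
move=> f1 f2 n1 n2; rewrite (int_shift_const (f2 n1)).
exact: (int_shift_const (fun n => f1 n 0)).
Qed.

(** * Four-rowed matrices and homogeneous coordinates *)

Section Rows.
Variable R : realType.
Implicit Types (u v w x : 'rV[R]_4) (M : 'M[R]_4).

Lemma rv4E (a b c d : R) (i : 'I_1) (j : 'I_4) :
  rv4 a b c d i j = nth 0 [:: a; b; c; d] j.
Proof. by rewrite mxE. Qed.

Lemma mx_rows4K M : M = mx_rows4 (row 0 M) (row 1 M) (row 2%:R M) (row 3%:R M).
Proof.
apply/matrixP=> i j; rewrite !mxE.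
by case: i => -[|[|[|[|//]]]] lti /=; rewrite mxE; congr (M _ _); apply: val_inj.
Qed.

Lemma row0_mx_rows4 u v w x : row 0 (mx_rows4 u v w x) = u.
Proof. by apply/rowP=> j; rewrite !mxE. Qed.

Lemma mx_rows4_inj u v w x u' v' w' x' :
  mx_rows4 u v w x = mx_rows4 u' v' w' x' ->
  [/\ u = u', v = v', w = w' & x = x'].
Proof.
move=> /matrixP E.
by split; apply/rowP=> j;
  [move: (E 0 j)|move: (E 1 j)|move: (E 2%:R j)|move: (E 3%:R j)]; rewrite !mxE.
Qed.

Lemma mul_rv4_rows4 (a b c d : R) u v w x :
  rv4 a b c d *m mx_rows4 u v w x = a *: u + b *: v + c *: w + d *: x.
Proof.
by apply/rowP=> j; rewrite mxE !big_ord_recl big_ord0 !mxE /= addr0 !addrA.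
Qed.

Lemma mul_rows4 u v w x M :
  mx_rows4 u v w x *m M = mx_rows4 (u *m M) (v *m M) (w *m M) (x *m M).
Proof.
by apply/row_matrixP=> i; rewrite row_mul !rowK; case: i => -[|[|[|[|//]]]].
Qed.

Lemma mx_rows4_1 :
  mx_rows4 (rv4 1 0 0 0) (rv4 0 1 0 0) (rv4 0 0 1 0) (rv4 0 0 0 1) = 1%:M :> 'M[R]_4.
Proof.
apply/matrixP=> i j; rewrite !mxE.
by case: i => -[|[|[|[|//]]]] lti; case: j => -[|[|[|[|//]]]] ltj; rewrite rv4E.
Qed.

(** Equality is tested separately on the affine part and on the homogenising
    coordinate. *)
Lemma row31P u v :
  (forall j : 'I_3, u 0 (lshift 1 j) = v 0 (lshift 1 j)) ->
  u 0 (rshift 3 0) = v 0 (rshift 3 0) -> u = v.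
Proof.
move=> El Er; apply/rowP=> j.
by case: (@split_ordP 3 1 j) => k -> //; rewrite ord1.
Qed.

Lemma homogeneousEl (v : 'rV[R]_3) (j : 'I_3) : homogeneous v 0 (lshift 1 j) = v 0 j.
Proof. exact: row_mxEl. Qed.

Lemma homogeneousEr (v : 'rV[R]_3) : homogeneous v 0 (rshift 3 0) = 1.
Proof. by rewrite [LHS](row_mxEr v) mxE. Qed.

Lemma row_addE n (u v : 'rV[R]_n) j : (u + v) 0 j = u 0 j + v 0 j.
Proof. by rewrite mxE. Qed.

Lemma row_oppE n (u : 'rV[R]_n) j : (- u) 0 j = - u 0 j.
Proof. by rewrite mxE. Qed.

Lemma row_scaleE n a (u : 'rV[R]_n) j : (a *: u) 0 j = a * u 0 j.
Proof. by rewrite mxE. Qed.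

Lemma row_zeroE n j : (0 : 'rV[R]_n) 0 j = 0.
Proof. by rewrite mxE. Qed.

Definition row_entryE :=
  (row_addE, row_oppE, row_scaleE, row_zeroE, homogeneousEl, homogeneousEr).

End Rows.

(** * The frame of an affine lattice *)

Section AffineFrame.
Variable R : realType.

(** The last row solves [rho_12 = H (rho + rho^1 + rho^2 + rho^12)] for [rho^12] when
    [r_12 + r = H (r_1 + r_2)]; [homogeneous 0] is the center of the affine sphere. *)
Definition affine_frame (H : int -> int -> R) (r : int -> int -> 'rV[R]_3)
    (n1 n2 : int) : 'M[R]_4 :=
  let h := H n1 n2 in
  let rho := homogeneous (r n1 n2) in
  mx_rows4 rho (homogeneous (shift1 r n1 n2) - rho)
    (homogeneous (shift2 r n1 n2) - rho)
    (((h - 1) / h) *: (rho - 2%:R *: homogeneous 0)).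

Variables H A Q : int -> int -> R.
Hypothesis hden : denominators_neq0 H A Q.

Let H_neq0 n1 n2 : H n1 n2 != 0.
Proof. by case: (hden n1 n2). Qed.

Let Hm1_neq0 n1 n2 : H n1 n2 - 1 != 0.
Proof. by case: (hden n1 n2). Qed.

Local Ltac lattice_field := field; by rewrite ?H_neq0 ?Hm1_neq0.

(** The Gauss-Weingarten equations express [r_11], [r_12] and [r_22] through
    [r, r_1, r_2]; after elimination each row is an
    identity of rational functions, in the affine coordinates and in the last one. *)
Lemma affine_frame_equations (r : int -> int -> 'rV[R]_3) :
  discrete_affine_sphere H A Q r -> frame_equations H A Q (affine_frame H r).
Proof.
move=> sph n1 n2; have [/rowP E11 /rowP E12 /rowP E22] := sph n1 n2.
rewrite /frame_mx1 /frame_mx2 /affine_frame !mul_rows4 !mul_rv4_rows4.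
rewrite /shift1 /shift2 in E11 E12 E22 *.
split; congr mx_rows4; apply: row31P => [j|]; rewrite !row_entryE.
all: try (move: (E11 j) (E22 j) (E12 j); rewrite !row_entryE;
  move=> /(canRL (subrK _)) e11 /(canRL (subrK _)) e22 /(canRL (addrK _)) e12;
  rewrite ?e11 ?e22 ?e12).
all: lattice_field.
Qed.

(** Only three rows carry information: the second and third of the first equation
    give [r_11] and [r_12], and the third of the second equation gives [r_22]. *)
Lemma affine_sphere_of_frame_equations (r : int -> int -> 'rV[R]_3) :
  frame_equations H A Q (affine_frame H r) -> discrete_affine_sphere H A Q r.
Proof.
move=> feq n1 n2; have [] := feq n1 n2.
rewrite /frame_mx1 /frame_mx2 /affine_frame !mul_rows4 !mul_rv4_rows4.
case/mx_rows4_inj=> _ /rowP E11 /rowP E12 _.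
case/mx_rows4_inj=> _ _ /rowP E22 _.
split; apply/rowP=> j.
all: move: (E11 (lshift 1 j)) (E22 (lshift 1 j)) (E12 (lshift 1 j)).
all: rewrite /shift1 /shift2 !row_entryE.
all: move=> /(canRL (subrK _)) e11 /(canRL (subrK _)) e22 /(canRL (subrK _)) e12.
all: rewrite ?e11 ?e22 ?e12.
all: lattice_field.
Qed.

(** Expresses the affine frame through [rho, rho_1, rho_2, rho_12]. *)
Definition neighbour_mx (h : R) : 'M[R]_4 :=
  mx_rows4 (rv4 1 0 0 0) (rv4 (-1) 1 0 0) (rv4 (-1) 0 1 0) (rv4 1 (-1) (-1) h^-1).

Lemma neighbour_mx_unit h : h != 0 -> neighbour_mx h \in unitmx.
Proof.
move=> h0; pose N := mx_rows4 (rv4 1 0 0 0) (rv4 1 1 0 0) (rv4 1 0 1 0) (rv4 h h h h).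
suff /mulmx1_unit[] : neighbour_mx h *m N = 1%:M by [].
rewrite mul_rows4 !mul_rv4_rows4 -mx_rows4_1.
by congr mx_rows4; apply/rowP=> -[[|[|[|[|//]]]] ltj]; rewrite !mxE /=; field.
Qed.

(** In the last row, [rho_12 / H - rho_1 - rho_2 + rho] equals
    [(H - 1) / H (rho - 2 e)]: this is the relation [r_12 + r = H (r_1 + r_2)] divided
    by [H] in the affine coordinates, and [1 / H - 1 = - (H - 1) / H] in the last one. *)
Lemma affine_frame_neighbours (r : int -> int -> 'rV[R]_3) n1 n2 :
  discrete_affine_sphere H A Q r ->
  affine_frame H r n1 n2 =
    neighbour_mx (H n1 n2) *m
    mx_rows4 (homogeneous (r n1 n2)) (homogeneous (shift1 r n1 n2))
      (homogeneous (shift2 r n1 n2)) (homogeneous (shift2 (shift1 r) n1 n2)).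
Proof.
move=> sph; have [_ /rowP E12 _] := sph n1 n2.
rewrite mul_rows4 !mul_rv4_rows4.
congr mx_rows4; apply: row31P => [j|]; rewrite !row_entryE.
all: try (move: (E12 j); rewrite !row_entryE => /(canRL (addrK _)) e12; rewrite ?e12).
all: lattice_field.
Qed.

Lemma affine_frame_nondegenerate (r : int -> int -> 'rV[R]_3) :
  discrete_affine_sphere H A Q r ->
  affine_nondegenerate r <-> frame_nondegenerate (affine_frame H r).
Proof.
move=> sph; split=> nd n1 n2; move: (nd n1 n2);
  by rewrite affine_frame_neighbours // !row_free_unit unitmx_mul neighbour_mx_unit.
Qed.

(** * Conserved quantities *)

(** The values on the rows of a frame of a functional equal to 1 on the whole
    lattice: it vanishes on the differences [rhat^1] and [rhat^2]. *)
Definition height_col n1 n2 : 'cV[R]_4 := (rv4 1 0 0 ((1 - H n1 n2) / H n1 n2))^T.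

(** The coefficients of [rhat - H / (H - 1) rhat^12]; on an affine frame this
    combination is twice the center. *)
Definition center_row n1 n2 : 'rV[R]_4 := rv4 1 0 0 (- (H n1 n2 / (H n1 n2 - 1))).

Lemma frame_mx1_height n1 n2 :
  frame_mx1 H A n1 n2 *m height_col n1 n2 = height_col (n1 + 1) n2.
Proof.
apply/colP=> i; rewrite !mxE !big_ord_recl big_ord0 !mxE.
case: i => -[|[|[|[|//]]]] lti /=; rewrite !mxE /= /shift1; lattice_field.
Qed.

Lemma frame_mx2_height n1 n2 :
  frame_mx2 H Q n1 n2 *m height_col n1 n2 = height_col n1 (n2 + 1).
Proof.
apply/colP=> i; rewrite !mxE !big_ord_recl big_ord0 !mxE.
case: i => -[|[|[|[|//]]]] lti /=; rewrite !mxE /= /shift2; lattice_field.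
Qed.

Lemma center_frame_mx1 n1 n2 :
  center_row (n1 + 1) n2 *m frame_mx1 H A n1 n2 = center_row n1 n2.
Proof.
rewrite mul_rv4_rows4; apply/rowP=> -[[|[|[|[|//]]]] ltj]; rewrite !mxE /= /shift1;
  lattice_field.
Qed.

Lemma center_frame_mx2 n1 n2 :
  center_row n1 (n2 + 1) *m frame_mx2 H Q n1 n2 = center_row n1 n2.
Proof.
rewrite mul_rv4_rows4; apply/rowP=> -[[|[|[|[|//]]]] ltj]; rewrite !mxE /= /shift2;
  lattice_field.
Qed.

(** The shifted coefficients times the frame matrix are the unshifted ones, so the
    combination takes the same value at neighbouring points. *)
Lemma center_conserved F n1 n2 : frame_equations H A Q F ->
  center_row n1 n2 *m F n1 n2 = center_row 0 0 *m F 0 0.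
Proof.
move=> feq; pose e m1 m2 := center_row m1 m2 *m F m1 m2.
apply: (@lattice_shift_const _ e) => m1 m2; have [F1 F2] := feq m1 m2.
  by rewrite /e /shift1 [F _ _]F1 mulmxA center_frame_mx1.
by rewrite /e /shift2 [F _ _]F2 mulmxA center_frame_mx2.
Qed.

(** The functional [F^-1 height_col] is shift invariant, since both [F] and
    [height_col] are multiplied by the same frame matrix. *)
Lemma height_conserved F n1 n2 :
  frame_equations H A Q F -> frame_nondegenerate F ->
  F n1 n2 *m (invmx (F 0 0) *m height_col 0 0) = height_col n1 n2.
Proof.
move=> feq nd; pose l m1 m2 := invmx (F m1 m2) *m height_col m1 m2.
have Fu m1 m2 : F m1 m2 \in unitmx by rewrite -row_free_unit.
have Fl m1 m2 : F m1 m2 *m l m1 m2 = height_col m1 m2 by rewrite mulKVmx.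
rewrite -[RHS]Fl; congr (_ *m _); apply/esym.
apply: (@lattice_shift_const _ l) => m1 m2; have [F1 F2] := feq m1 m2.
  by rewrite /shift1 [LHS]/l -frame_mx1_height -Fl mulmxA -[_ *m F _ _]F1 mulKmx.
by rewrite /shift2 [LHS]/l -frame_mx2_height -Fl mulmxA -[_ *m F _ _]F2 mulKmx.
Qed.

(** * Normalisation at the origin *)

Lemma homogeneous0 : homogeneous 0 = rv4 0 0 0 1 :> 'rV[R]_4.
Proof.
apply: row31P => [j|]; rewrite row_entryE rv4E //= ?row_zeroE.
by case: j => -[|[|[|//]]].
Qed.

(** The height puts the first row in the chart where the last coordinate is 1, the
    frame equations give the two difference rows, and the center determines the
    last row from the first. *)
Lemma affine_frame_of_normalized F :
  frame_equations H A Q F ->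
  (forall n1 n2, F n1 n2 *m (homogeneous 0)^T = height_col n1 n2) ->
  (forall n1 n2, center_row n1 n2 *m F n1 n2 = 2%:R *: homogeneous 0) ->
  forall n1 n2, F n1 n2 = affine_frame H (fun m1 m2 => @lsubmx R 1 3 1 (row 0 (F m1 m2))) n1 n2.
Proof.
move=> feq Fl Fe; set r := fun m1 m2 => _.
have row0F m1 m2 : row 0 (F m1 m2) = homogeneous (r m1 m2).
  apply: row31P => [j|]; first by rewrite homogeneousEl !mxE.
  rewrite homogeneousEr; move/colP/(_ 0): (Fl m1 m2).
  rewrite homogeneous0 !mxE !big_ord_recl big_ord0 !mxE /=.
  rewrite !(mulr0, mulr1, add0r, addr0) => <-.
  by congr (F _ _ _ _); apply: val_inj.
move=> n1 n2; have [F1 F2] := feq n1 n2; rewrite /affine_frame -!row0F.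
rewrite {1}[F n1 n2]mx_rows4K; congr mx_rows4.
- rewrite [F (n1 + 1) _]F1 row_mul row0_mx_rows4 [X in _ *m X]mx_rows4K.
  by rewrite mul_rv4_rows4 !scale1r !scale0r !addr0 addrAC subrr add0r.
- rewrite [F _ (n2 + 1)]F2 row_mul row0_mx_rows4 [X in _ *m X]mx_rows4K.
  by rewrite mul_rv4_rows4 !scale1r !scale0r !addr0 addrAC subrr add0r.
- rewrite -(Fe n1 n2) [X in _ *m X]mx_rows4K mul_rv4_rows4.
  by apply/rowP=> j; rewrite !row_entryE; lattice_field.
Qed.

(** For [k = (h - 1) / h] this is the simplest invertible frame with
    height values [1, 0, 0, - k] in the last column and with
    [rhat - k^-1 rhat^12 = 2 e]. *)
Definition origin_frame (k : R) : 'M[R]_4 :=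
  mx_rows4 (rv4 0 0 1 1) (rv4 1 0 0 0) (rv4 0 1 0 0) (rv4 0 0 k (- k)).

Lemma origin_frame_unit k : k != 0 -> origin_frame k \in unitmx.
Proof.
move=> k0.
pose N : 'M[R]_4 := mx_rows4 (rv4 0 1 0 0) (rv4 0 0 1 0)
  (rv4 2^-1 0 0 (2 * k)^-1) (rv4 2^-1 0 0 (- (2 * k)^-1)).
suff /mulmx1_unit[] : N *m origin_frame k = 1%:M by [].
rewrite mul_rows4 !mul_rv4_rows4 -mx_rows4_1.
by congr mx_rows4; apply/rowP=> -[[|[|[|[|//]]]] ltj]; rewrite !mxE /=; field.
Qed.

End AffineFrame.

Lemma frame_equations_mulr (R : realType) (H A Q : int -> int -> R) F (S : 'M[R]_4) :
  frame_equations H A Q F -> frame_equations H A Q (fun n1 n2 => F n1 n2 *m S).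
Proof.
by move=> feq n1 n2; have [F1 F2] := feq n1 n2;
  rewrite !mulmxA -F1 -F2.
Qed.

Lemma frame_nondegenerate_mulr (R : realType) F (S : 'M[R]_4) :
  S \in unitmx -> frame_nondegenerate F -> frame_nondegenerate (fun n1 n2 => F n1 n2 *m S).
Proof.
by move=> Su nd n1 n2; rewrite row_free_unit unitmx_mul -row_free_unit nd.
Qed.

Theorem mainTheorem10 (R : realType) (H A Q : int -> int -> R)
    (hden : denominators_neq0 H A Q)
    (hTz : discrete_tzitzeica H A Q)
    (r : int -> int -> 'rV[R]_4) :
  (exists F : int -> int -> 'M[R]_4,
     [/\ frame_equations H A Q F,
         frame_nondegenerate F
       & forall n1 n2 : int, row 0 (F n1 n2) = r n1 n2])
  <->
  (exists (T : 'M[R]_4) (ra : int -> int -> 'rV[R]_3),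
     [/\ T \in unitmx,
         discrete_affine_sphere H A Q ra,
         affine_nondegenerate ra
       & forall n1 n2 : int, r n1 n2 = homogeneous (ra n1 n2) *m T]).
Proof.
split=> [[F [feq nd rF]]|[T [ra [Tu sph nd rT]]]]; last first.
  exists (fun n1 n2 => affine_frame H ra n1 n2 *m T); split.
  - exact/frame_equations_mulr/affine_frame_equations.
  - exact/frame_nondegenerate_mulr/(affine_frame_nondegenerate hden sph).
  - by move=> n1 n2; rewrite rT row_mul row0_mx_rows4.
have [h0 hm0 _] := hden 0 0; set h := H 0 0 in h0 hm0.
pose G := origin_frame ((h - 1) / h).
have Gu : G \in unitmx by rewrite origin_frame_unit // mulf_neq0 ?invr_eq0.
have Fu n1 n2 : F n1 n2 \in unitmx by rewrite -row_free_unit.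
(* With this change of coordinates the frame at the origin becomes G. *)
pose S := invmx (F 0 0) *m G.
have Su : S \in unitmx by rewrite unitmx_mul unitmx_inv Fu.
have feqS := frame_equations_mulr S feq.
have FSe n1 n2 : F n1 n2 *m S *m (homogeneous 0)^T = height_col H n1 n2.
  rewrite -(height_conserved hden n1 n2 feq nd) -!mulmxA; congr (_ *m (_ *m _)).
  apply/colP=> i; rewrite /G homogeneous0 !mxE !big_ord_recl big_ord0 !mxE -/h.
  by case: i => -[|[|[|[|//]]]] lti /=; rewrite !mxE /=; field.
have eFS n1 n2 : center_row H n1 n2 *m (F n1 n2 *m S) = 2%:R *: homogeneous 0.
  rewrite mulmxA (center_conserved hden n1 n2 feq) mulmxA mulmxK // homogeneous0.
  rewrite mul_rv4_rows4; apply/rowP=> -[[|[|[|[|//]]]] ltj]; rewrite !mxE /= -/h; field;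
    by rewrite ?h0 ?hm0.
have FSE := affine_frame_of_normalized hden feqS FSe eFS.
set ra := fun n1 n2 => _ in FSE.
have sph : discrete_affine_sphere H A Q ra.
  by apply: (affine_sphere_of_frame_equations hden) => n1 n2; have := feqS n1 n2;
    rewrite /shift1 /shift2 !FSE.
exists (invmx S), ra; split=> //.
- by rewrite unitmx_inv.
- apply/(affine_frame_nondegenerate hden sph) => n1 n2.
  by rewrite -FSE; apply: frame_nondegenerate_mulr.
- move=> n1 n2; have /(congr1 (row 0)) := FSE n1 n2.
  by rewrite row0_mx_rows4 row_mul rF => <-; rewrite mulmxK.
Qed.
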